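(* Let $M = cQ + \varepsilon D \in \mathbb{DH}[t]$, with $c\in\mathbb{R}[t]$ and $Q,D\in\mathbb{H}[t]$, be a bounded, monic, reduced motion polynomial of degree $n$ with $\operatorname{mrpf}(Q) = 1$ and $\nu(M) =c^2\nu(Q) = N^n$ for some irreducible quadratic polynomial $N \in \mathbb{R}[t]$. Set $g_L := \operatorname{mrpf}(c,Q^{*}D)$ and $g_R := \operatorname{mrpf}(c,DQ^{*})$. If $M$ admits a factorization into monic linear motion polynomial factors, then $cg_L$ or $cg_R$ divides $\nu(D)$.
   Context: $\mathbb{H}$ denotes the real quaternions with conjugation $q\mapsto q^{*}$. The dual quaternions are $\mathbb{DH}=\mathbb{H}[\varepsilon]/(\varepsilon^2)$, where $\varepsilon$ commutes with everything; $(p+\varepsilon d)^{*}=p^{*}+\varepsilon d^{*}$. In $\mathbb{DH}[t]$ and $\mathbb{H}[t]$ the indeterminate $t$ commutes with all coefficients; $M^{*}$ is obtained by conjugating all coefficients and $\nu(M):=MM^{*}$. Every $M\in\mathbb{DH}[t]$ is uniquely $M=P+\varepsilon D$ with $P,D\in\mathbb{H}[t]$. $M$ is a motion polynomial if $MM^{*}\in\mathbb{R}[t]\setminus\{0\}$. Monic means leading coefficient $1$; linear means degree $1$. A real polynomial $F$ divides $M$ if $M=FM'$ for some polynomial $M'$ (so every nonzero real polynomial divides $0$). $\operatorname{mrpf}(A,B)$ is the greatest common monic real polynomial divisor of $A$ and $B$ (not both zero), $\operatorname{mrpf}(M):=\operatorname{mrpf}(M,M)$, $\operatorname{mrpf}(0):=1$.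 $M$ is reduced if $\operatorname{mrpf}(M)=1$. A monic reduced motion polynomial $M=P+\varepsilon D$ is bounded if $\operatorname{mrpf}(P)$ has no real zero. A factorization into monic linear motion polynomial factors is $M=(t-h_1)\cdots(t-h_n)$, $h_i\in\mathbb{DH}$, with each $t-h_i$ a motion polynomial. *)

(* Defs.v *)
From HB Require Import structures.
From mathcomp Require Import all_boot all_order all_algebra.
From mathcomp Require Import ring.
From mathcomp Require Import boolp classical_sets reals.

Set Implicit Arguments.
Unset Strict Implicit.
Unset Printing Implicit Defensive.

Import GRing.Theory.
Local Open Scope ring_scope.

(* Quat a b c d is a + b i + c j + d k, with i j = k. *)
Record quat (R : Type) : Type := Quat { q0 : R; q1 : R; q2 : R; q3 : R }.

Section QuatChoice.
Variable R : choiceType.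

Definition quat_tuple (x : quat R) : R * R * R * R :=
  (q0 x, q1 x, q2 x, q3 x).

Definition tuple_quat (u : R * R * R * R) : quat R :=
  let: (a, b, c, d) := u in Quat a b c d.

Lemma quat_tupleK : cancel quat_tuple tuple_quat.
Proof. by case. Qed.

HB.instance Definition _ := Choice.copy (quat R) (can_type quat_tupleK).

End QuatChoice.

Section QuatRing.
Variable R : comNzRingType.
Implicit Types x y : quat R.

Definition quat_zero : quat R := Quat 0 0 0 0.
Definition quat_one : quat R := Quat 1 0 0 0.
Definition quat_opp x : quat R := Quat (- q0 x) (- q1 x) (- q2 x) (- q3 x).
Definition quat_add x y : quat R :=
  Quat (q0 x + q0 y) (q1 x + q1 y) (q2 x + q2 y) (q3 x + q3 y).
Definition quat_mul x y : quat R :=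
  Quat (q0 x * q0 y - q1 x * q1 y - q2 x * q2 y - q3 x * q3 y)
       (q0 x * q1 y + q1 x * q0 y + q2 x * q3 y - q3 x * q2 y)
       (q0 x * q2 y - q1 x * q3 y + q2 x * q0 y + q3 x * q1 y)
       (q0 x * q3 y + q1 x * q2 y - q2 x * q1 y + q3 x * q0 y).
Definition quat_scale (a : R) x : quat R :=
  Quat (a * q0 x) (a * q1 x) (a * q2 x) (a * q3 x).

Definition quat_conj x : quat R := Quat (q0 x) (- q1 x) (- q2 x) (- q3 x).

Lemma quat_addA : associative quat_add.
Proof. by case=> a b c d [? ? ? ?] [? ? ? ?]; congr Quat => /=; ring. Qed.
Lemma quat_addC : commutative quat_add.
Proof. by case=> a b c d [? ? ? ?]; congr Quat => /=; ring. Qed.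
Lemma quat_add0 : left_id quat_zero quat_add.
Proof. by case=> a b c d; congr Quat => /=; ring. Qed.
Lemma quat_addN : left_inverse quat_zero quat_opp quat_add.
Proof. by case=> a b c d; congr Quat => /=; ring. Qed.

HB.instance Definition _ := GRing.isZmodule.Build (quat R)
  quat_addA quat_addC quat_add0 quat_addN.

Lemma quat_mulA : associative quat_mul.
Proof. by case=> a b c d [? ? ? ?] [? ? ? ?]; congr Quat => /=; ring. Qed.
Lemma quat_mul1l : left_id quat_one quat_mul.
Proof. by case=> a b c d; congr Quat => /=; ring. Qed.
Lemma quat_mul1r : right_id quat_one quat_mul.
Proof. by case=> a b c d; congr Quat => /=; ring. Qed.
Lemma quat_mulDl : left_distributive quat_mul quat_add.
Proof. by case=> a b c d [? ? ? ?] [? ? ? ?]; congr Quat => /=; ring. Qed.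
Lemma quat_mulDr : right_distributive quat_mul quat_add.
Proof. by case=> a b c d [? ? ? ?] [? ? ? ?]; congr Quat => /=; ring. Qed.
Lemma quat_one_neq0 : quat_one != 0.
Proof. by apply/eqP => -[/eqP]; rewrite oner_eq0. Qed.

HB.instance Definition _ := GRing.Zmodule_isNzRing.Build (quat R)
  quat_mulA quat_mul1l quat_mul1r quat_mulDl quat_mulDr quat_one_neq0.

Lemma quat_scaleA a b x :
  quat_scale a (quat_scale b x) = quat_scale (a * b) x.
Proof. by congr Quat => /=; ring. Qed.
Lemma quat_scale1 : left_id 1 quat_scale.
Proof. by case=> a b c d; congr Quat => /=; ring. Qed.
Lemma quat_scaleDr : right_distributive quat_scale +%R.
Proof. by move=> a x y; congr Quat => /=; ring. Qed.
Lemma quat_scaleDl x : {morph quat_scale^~ x : a b / a + b}.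
Proof. by move=> a b; congr Quat => /=; ring. Qed.

HB.instance Definition _ := GRing.Zmodule_isLmodule.Build R (quat R)
  quat_scaleA quat_scale1 quat_scaleDr quat_scaleDl.

Lemma quat_scaleAl a x y : a *: (x * y) = (a *: x) * y.
Proof. by congr Quat => /=; ring. Qed.

HB.instance Definition _ :=
  GRing.Lmodule_isLalgebra.Build R (quat R) quat_scaleAl.

Lemma quat_scaleAr a x y : a *: (x * y) = x * (a *: y).
Proof. by congr Quat => /=; ring. Qed.

HB.instance Definition _ :=
  GRing.Lalgebra_isAlgebra.Build R (quat R) quat_scaleAr.

End QuatRing.

(* Dual p d is p + eps d in A[eps]/(eps^2), with eps central. *)
Record dual (A : Type) : Type := Dual { dprimal : A; ddual : A }.

Section DualChoice.
Variable A : choiceType.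

Definition dual_pair (x : dual A) : A * A := (dprimal x, ddual x).
Definition pair_dual (u : A * A) : dual A := Dual u.1 u.2.

Lemma dual_pairK : cancel dual_pair pair_dual.
Proof. by case. Qed.

HB.instance Definition _ := Choice.copy (dual A) (can_type dual_pairK).

End DualChoice.

Section DualRing.
Variable A : nzRingType.
Implicit Types x y : dual A.

Definition dual_zero : dual A := Dual 0 0.
Definition dual_one : dual A := Dual 1 0.
Definition dual_eps : dual A := Dual 0 1.
Definition dual_opp x : dual A := Dual (- dprimal x) (- ddual x).
Definition dual_add x y : dual A :=
  Dual (dprimal x + dprimal y) (ddual x + ddual y).
Definition dual_mul x y : dual A :=
  Dual (dprimal x * dprimal y) (dprimal x * ddual y + ddual x * dprimal y).

Lemma dual_addA : associative dual_add.
Proof. by move=> x y z; congr Dual; rewrite /= addrA. Qed.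
Lemma dual_addC : commutative dual_add.
Proof. by move=> x y; congr Dual; rewrite /= addrC. Qed.
Lemma dual_add0 : left_id dual_zero dual_add.
Proof. by case=> a b; congr Dual; rewrite /= add0r. Qed.
Lemma dual_addN : left_inverse dual_zero dual_opp dual_add.
Proof. by case=> a b; congr Dual; rewrite /= addNr. Qed.

HB.instance Definition _ := GRing.isZmodule.Build (dual A)
  dual_addA dual_addC dual_add0 dual_addN.

Lemma dual_mulA : associative dual_mul.
Proof.
by move=> x y z; congr Dual; rewrite /= ?mulrDl ?mulrDr !mulrA ?addrA.
Qed.
Lemma dual_mul1l : left_id dual_one dual_mul.
Proof. by case=> a b; congr Dual; rewrite /= !mul1r ?mul0r ?addr0. Qed.
Lemma dual_mul1r : right_id dual_one dual_mul.
Proof. by case=> a b; congr Dual; rewrite /= !mulr1 ?mulr0 ?add0r. Qed.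
Lemma dual_mulDl : left_distributive dual_mul dual_add.
Proof. by move=> x y z; congr Dual; rewrite /= !mulrDl // addrACA. Qed.
Lemma dual_mulDr : right_distributive dual_mul dual_add.
Proof. by move=> x y z; congr Dual; rewrite /= !mulrDr // addrACA. Qed.
Lemma dual_one_neq0 : dual_one != 0.
Proof. by apply/eqP => -[/eqP]; rewrite oner_eq0. Qed.

HB.instance Definition _ := GRing.Zmodule_isNzRing.Build (dual A)
  dual_mulA dual_mul1l dual_mul1r dual_mulDl dual_mulDr dual_one_neq0.

End DualRing.

Section DualAlg.
Variables (R : comNzRingType) (A : algType R).
Implicit Types x y : dual A.

Definition dual_scale (a : R) x : dual A := Dual (a *: dprimal x) (a *: ddual x).

Lemma dual_scaleA a b x :
  dual_scale a (dual_scale b x) = dual_scale (a * b) x.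
Proof. by congr Dual; rewrite /= scalerA. Qed.
Lemma dual_scale1 : left_id 1 dual_scale.
Proof. by case=> a b; congr Dual; rewrite /= scale1r. Qed.
Lemma dual_scaleDr : right_distributive dual_scale +%R.
Proof. by move=> a x y; congr Dual; rewrite /= scalerDr. Qed.
Lemma dual_scaleDl x : {morph dual_scale^~ x : a b / a + b}.
Proof. by move=> a b; congr Dual; rewrite /= scalerDl. Qed.

HB.instance Definition _ := GRing.Zmodule_isLmodule.Build R (dual A)
  dual_scaleA dual_scale1 dual_scaleDr dual_scaleDl.

Lemma dual_scaleAl a x y : a *: (x * y) = (a *: x) * y.
Proof. by congr Dual; rewrite /= ?scalerDr !scalerAl. Qed.

HB.instance Definition _ :=
  GRing.Lmodule_isLalgebra.Build R (dual A) dual_scaleAl.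

Lemma dual_scaleAr a x y : a *: (x * y) = x * (a *: y).
Proof. by congr Dual; rewrite /= ?scalerDr !scalerAr. Qed.

HB.instance Definition _ :=
  GRing.Lalgebra_isAlgebra.Build R (dual A) dual_scaleAr.

End DualAlg.

Section Mrpf.
Variables (R : fieldType) (A : algType R).
Implicit Types (B C : {poly A}) (f g : {poly R}).

(* R[t] embeds in A[t] through a |-> a *: 1. *)
Definition scalp_poly f : {poly A} := map_poly (in_alg A) f.

HB.instance Definition _ :=
  GRing.RMorphism.copy scalp_poly (map_poly (in_alg A)).

Definition rdvd f B : Prop := exists B' : {poly A}, B = scalp_poly f * B'.

Definition is_mrpf B C g : Prop :=
  [/\ g \is monic, rdvd g B, rdvd g C
    & forall f, f \is monic -> rdvd f B -> rdvd f C -> f %| g].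

(* If B or C is nonzero, the set below is a singleton (see mrpfP and
   is_mrpf_uniq); if B = C = 0 it is empty, and the value is 1. *)
Definition mrpf B C : {poly R} := xget 1 [set g | is_mrpf B C g].

Definition mrpf1 B : {poly R} := mrpf B B.

Lemma scalp_polyC f B : scalp_poly f * B = B * scalp_poly f.
Proof.
apply/polyP => i; rewrite coefM coefMr; apply: eq_bigr => j _.
by rewrite coef_map /= -scalerAl mul1r -scalerAr mulr1.
Qed.

Lemma size_rdvd f B : f \is monic -> B != 0 -> rdvd f B -> (size f <= size B)%N.
Proof.
move=> fm B0 [B' BE]; have B'0 : B' != 0.
  by apply: contraNneq B0 => B'0; rewrite BE B'0 mulr0.
rewrite BE size_monicM //; last exact: monic_map.
rewrite size_map_poly; move: B'0; rewrite -size_poly_gt0.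
by case: (size B') => // k _; rewrite addnS leq_addr.
Qed.

Lemma rdvd_lcm f g B : f \is monic -> g \is monic ->
  rdvd f B -> rdvd g B -> rdvd (f * (g %/ gcdp f g)) B.
Proof.
move=> fm gm [x fx] [y gy]; set d := gcdp f g.
have d0 : d != 0 by rewrite gcdp_eq0 negb_and monic_neq0.
have fE : f = f %/ d * d by rewrite divpK // dvdp_gcdl.
have gE : g = g %/ d * d by rewrite divpK // dvdp_gcdr.
have /Bezout_eq1_coprimepP[[u v] /= uv] : coprimep (f %/ d) (g %/ d).
  by rewrite coprimep_div_gcd // monic_neq0.
have dreg : GRing.lreg (scalp_poly d).
  apply: lreg_lead; rewrite lead_coef_map.
  move=> a b /=; rewrite -!scalerAl !mul1r => /scalerI; apply.
  by rewrite lead_coef_eq0.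
have xy : scalp_poly (f %/ d) * x = scalp_poly (g %/ d) * y.
  apply: dreg; rewrite !mulrA -!rmorphM /= ![d * _]mulrC -fE -gE.
  by rewrite -fx -gy.
exists (scalp_poly u * y + scalp_poly v * x).
rewrite rmorphM /= -mulrA mulrDr fx; congr (_ * _).
rewrite -[LHS]mul1r -[1](rmorph1 scalp_poly) -uv rmorphD !rmorphM /=.
rewrite mulrDl -!mulrA; congr (_ + _); last first.
  by rewrite !mulrA -!rmorphM /= [v * _]mulrC.
rewrite xy !mulrA -!rmorphM /=.
by rewrite [u * _]mulrC.
Qed.

Lemma mrpfP B C : B != 0 \/ C != 0 -> is_mrpf B C (mrpf B C).
Proof.
move=> BC0; apply: (@xgetPex _ 1 [set g | is_mrpf B C g]%classic).
pose cd f := [/\ f \is monic, rdvd f B & rdvd f C].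
pose P k := `[< exists2 f, cd f & size f = k >].
have exP : exists k, P k.
  exists (size (1 : {poly R})); apply/asboolP; exists 1 => //.
  by split; [exact: monic1 | exists B | exists C]; rewrite rmorph1 mul1r.
have ubP k : P k -> (k <= maxn (size B) (size C))%N.
  move=> /asboolP[f [fm fB fC] <-]; rewrite leq_max.
  by case: BC0 => h; rewrite (size_rdvd fm h) // orbT.
case: (ex_maxnP exP ubP) => k /asboolP[g [gm gB gC] gk] kmax.
exists g; split=> // f fm fB fC.
set q := f %/ gcdp g f.
have q0 : q != 0.
  by rewrite divp_eq0 !negb_or monic_neq0 // gcdp_eq0 negb_and !monic_neq0 //=
             -leqNgt (leq_gcdpr _ (monic_neq0 fm)).
have gq0 : g * q != 0 by rewrite mulf_neq0 // monic_neq0.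
set c := (lead_coef (g * q))^-1.
have c0 : c != 0 by rewrite invr_eq0 lead_coef_eq0.
have dvZ X : rdvd g X -> rdvd f X -> rdvd (c *: (g * q)) X.
  move=> gX fX; have [Y ->] := rdvd_lcm gm fm gX fX.
  exists (scalp_poly c^-1%:P * Y); rewrite mulrA -rmorphM /= -scalerAl.
  by rewrite [_ * c^-1%:P]mulrC mul_polyC scalerA divff // scale1r.
have : P (size (c *: (g * q))).
  apply/asboolP; exists (c *: (g * q)) => //; split; [|exact: dvZ|exact: dvZ].
  by rewrite monicE lead_coefZ mulVf // lead_coef_eq0.
move=> /kmax; rewrite -gk size_scale // (size_mul (monic_neq0 gm) q0) => sz.
have q1 : (size q <= 1)%N.
  have : (0 < size g)%N by rewrite size_poly_gt0 monic_neq0.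
  by case: (size g) sz => // m; rewrite addSn /= -[X in (_ <= X)%N]addn1 leq_add2l.
have fE : f = q * gcdp g f by rewrite divpK // dvdp_gcdr.
have qC := size1_polyC q1; rewrite qC polyC_eq0 in q0.
rewrite fE qC mul_polyC dvdpZl //; exact: dvdp_gcdl.
Qed.

Lemma is_mrpf_uniq B C f g : is_mrpf B C f -> is_mrpf B C g -> f = g.
Proof.
move=> [fm fB fC fmax] [gm gB gC gmax].
by apply/eqP; rewrite -eqp_monic // /eqp gmax // fmax.
Qed.

End Mrpf.

Arguments scalp_poly {R A} f.

Notation dquat R := (dual (quat R)).

Section MotionPolynomials.
Variable R : realType.
Implicit Types (P D : {poly quat R}) (M : {poly dquat R}) (F : {poly R}).

Definition dquat_conj (x : dquat R) : dquat R :=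
  Dual (quat_conj (dprimal x)) (quat_conj (ddual x)).

Definition conjH P : {poly quat R} := map_poly (@quat_conj R) P.
Definition conjDH M : {poly dquat R} := map_poly dquat_conj M.

Definition nuH P : {poly quat R} := P * conjH P.
Definition nuDH M : {poly dquat R} := M * conjDH M.

Definition liftH P : {poly dquat R} := map_poly (fun a => Dual a 0) P.
Definition primal_part M : {poly quat R} := map_poly (@dprimal (quat R)) M.
Definition epsilon : {poly dquat R} := (dual_eps (quat R))%:P.

Definition motion_poly M : Prop := exists2 F, F != 0 & nuDH M = scalp_poly F.

Definition reduced M : Prop := mrpf1 M = 1.

Definition bounded M : Prop :=
  [/\ M \is monic, reduced M, motion_poly M
    & forall x : R, ~~ root (mrpf1 (primal_part M)) x].

(* Factors are multiplied in the order of the list. *)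
Definition admits_linear_factorization M : Prop :=
  exists hs : seq (dquat R),
    (forall h, h \in hs -> motion_poly ('X - h%:P)) /\
    M = \prod_(h <- hs) ('X - h%:P).

End MotionPolynomials.

(* Main.v *)
Require Import Defs.
From mathcomp Require Import all_boot all_order all_algebra.
From mathcomp Require Import ring.
From mathcomp Require Import reals.

(** Write a motion polynomial as [P + eps D] and read [P] and [D] as
    quaternions with coefficients in [R[t]].  The primal norms of the linear
    factors are monic quadratic polynomials with product [N ^+ n], so each of
    them is [N] (up to a constant), and [c] is a power [N ^+ a] (up to a
    constant).

    Modulo [N] the quaternions form an algebra of 2 x 2 matrices over the field
    [R[t]/N], and the primal parts of a factorization describe a path in a
    tree.  The path runs between the ends of a geodesic (given by [Q]) and
    makes [a] backward steps, one for each factor [N] of [c].  Two backward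
    steps that belong to different excursions would force [N] to divide the
    whole product: each excursion contributes a factor with primal part
    divisible by [N], and a product of two such factors is divisible by [N].
    As [M] is reduced there is at most one excursion, that is
    [M = A (N ^+ a + eps E) C], where the primal parts satisfy
    [A0 C0 = Q] (up to a constant) and have norms [N ^+ j] and [N ^+ k].
    Moreover [E] is skew and [N ^+ a] divides its norm, because along an
    excursion the factors pair up as [T ... T^*] (lemmas [backtrack] and
    [excursion]).

    Expanding, [D = A0 E C0 + N ^+ a (A1 C0 + A0 C1)].  The norm of the first
    summand is divisible by [N ^+ (j + k + a)], that of the second one by
    [N ^+ (a + a)], and the polar term of the two by [N ^+ (a + minn j k)]
    (lemma [exp_dvd_qnorm_dual]).  It remains to bound [gL] and [gR].
    Modulo [N ^+ a], the product [Q^* D] is [N ^+ j C0^* E C0], so if [gL] were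
    divisible by [N ^+ j.+1] then [N] would divide [C0^* E C0].  As [E] is
    nilpotent modulo [N], this is only possible if [N] divides [E C0]
    (lemma [qdvd_isotropic]), hence [D], against reducedness.  Thus [gL]
    divides [N ^+ j] and, symmetrically, [gR] divides [N ^+ k]; the smaller of
    [j] and [k] decides which of [c gL] and [c gR] divides the norm of [D]. *)

Set Implicit Arguments.
Unset Strict Implicit.
Unset Printing Implicit Defensive.

Import Order.TTheory GRing.Theory Num.Theory.
Local Open Scope ring_scope.

(** * Norm and trace identities for quaternions *)

Section QuaternionAlgebra.
Variable A : comNzRingType.
Implicit Types (a b : A) (x y z : quat A).

Definition qnorm x : A := q0 x ^+ 2 + q1 x ^+ 2 + q2 x ^+ 2 + q3 x ^+ 2.

Lemma quat_ext x y : q0 x = q0 y -> q1 x = q1 y -> q2 x = q2 y -> q3 x = q3 y ->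
  x = y.
Proof. by case: x => ? ? ? ?; case: y => ? ? ? ? /= -> -> -> ->. Qed.

Lemma quat_conjK x : quat_conj (quat_conj x) = x.
Proof. by apply: quat_ext => //=; ring. Qed.

Lemma quat_conjD x y : quat_conj (x + y) = quat_conj x + quat_conj y.
Proof. by apply: quat_ext => /=; ring. Qed.

Lemma quat_conjN x : quat_conj (- x) = - quat_conj x.
Proof. by apply: quat_ext => /=; ring. Qed.

Lemma quat_conjM x y : quat_conj (x * y) = quat_conj y * quat_conj x.
Proof. by apply: quat_ext => /=; ring. Qed.

Lemma quat_conjZ a x : quat_conj (a *: x) = a *: quat_conj x.
Proof. by apply: quat_ext => /=; ring. Qed.

Lemma quat_conj0 : quat_conj (0 : quat A) = 0.
Proof. by apply: quat_ext => /=; ring. Qed.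

Lemma mul_quat_conj x : x * quat_conj x = (qnorm x)%:A.
Proof. by apply: quat_ext; rewrite /= /qnorm; ring. Qed.

Lemma mul_conj_quat x : quat_conj x * x = (qnorm x)%:A.
Proof. by apply: quat_ext; rewrite /= /qnorm; ring. Qed.

Lemma qnorm1 : qnorm 1 = 1.
Proof. by rewrite /qnorm /=; ring. Qed.

Lemma qnormM x y : qnorm (x * y) = qnorm x * qnorm y.
Proof. by rewrite /qnorm /=; ring. Qed.

Lemma qnorm_conj x : qnorm (quat_conj x) = qnorm x.
Proof. by rewrite /qnorm /=; ring. Qed.

Lemma qnormZ a x : qnorm (a *: x) = a ^+ 2 * qnorm x.
Proof. by rewrite /qnorm /=; ring. Qed.

Lemma qnormD x y :
  qnorm (x + y) = qnorm x + qnorm y + q0 (x * quat_conj y) *+ 2.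
Proof. by rewrite /qnorm /=; ring. Qed.

Lemma q0D x y : q0 (x + y) = q0 x + q0 y.
Proof. by []. Qed.

Lemma q0Z a x : q0 (a *: x) = a * q0 x.
Proof. by []. Qed.

Lemma q0_mulC x y : q0 (x * y) = q0 (y * x).
Proof. by rewrite /=; ring. Qed.

(** Cayley-Hamilton in polarized form: [x y + (x y)^*] is the scalar trace of
    [x y], and [(x y)^* x = y^* x^* x] produces the norm of [x].  For [x] of
    norm zero it says that [x y x] is a multiple of [x], as for a matrix of
    rank one. *)
Lemma quat_sandwich x y :
  x * y * x = (q0 (x * y) *+ 2) *: x - qnorm x *: quat_conj y.
Proof. by apply: quat_ext; rewrite /= /qnorm; ring. Qed.

End QuaternionAlgebra.

(** * Divisibility of quaternions by real polynomials *)

Section PolynomialQuaternions.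
Variable R : realFieldType.
Implicit Types (a b f g N : {poly R}) (x y z : quat {poly R}).

Definition qdvd f x : bool :=
  [&& f %| q0 x, f %| q1 x, f %| q2 x & f %| q3 x].

Lemma qdvdP f x : reflect (exists y, x = f *: y) (qdvd f x).
Proof.
apply: (iffP and4P) => [[/dvdpP[a Ha] /dvdpP[b Hb] /dvdpP[c Hc] /dvdpP[d Hd]]|].
  by exists (Quat a b c d); apply: quat_ext; rewrite /= mulrC.
by case=> y ->; rewrite /= !dvdp_mulIl.
Qed.

Lemma qdvdZ f x : qdvd f (f *: x).
Proof. by apply/qdvdP; exists x. Qed.

Lemma qdvdD f x y : qdvd f x -> qdvd f y -> qdvd f (x + y).
Proof.
by move=> /qdvdP[u ->] /qdvdP[v ->]; rewrite -scalerDr qdvdZ.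
Qed.

Lemma qdvdN f x : qdvd f (- x) = qdvd f x.
Proof. by rewrite /qdvd /= !dvdpNr. Qed.

Lemma qdvdDr f x y : qdvd f x -> qdvd f (x + y) = qdvd f y.
Proof.
move=> fx; apply/idP/idP => [h|]; last exact: qdvdD.
by rewrite -[y](addKr x) qdvdD ?qdvdN.
Qed.

Lemma qdvd_mull f x y : qdvd f y -> qdvd f (x * y).
Proof. by move=> /qdvdP[u ->]; rewrite -scalerAr qdvdZ. Qed.

Lemma qdvd_mulr f x y : qdvd f x -> qdvd f (x * y).
Proof. by move=> /qdvdP[u ->]; rewrite -scalerAl qdvdZ. Qed.

Lemma qdvd_conj f x : qdvd f (quat_conj x) = qdvd f x.
Proof. by rewrite /qdvd /= !dvdpNr. Qed.

Lemma qdvd_scale f a x : f %| a -> qdvd f (a *: x).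
Proof. by case/dvdpP => b ->; rewrite mulrC -scalerA qdvdZ. Qed.

Lemma qdvd_trans f g x : f %| g -> qdvd g x -> qdvd f x.
Proof. by move=> fg /qdvdP[y ->]; exact: qdvd_scale. Qed.

Lemma qdvd_scale2 f g x : g != 0 -> qdvd (g * f) (g *: x) = qdvd f x.
Proof. by move=> g0; rewrite /qdvd /= !dvdp_mul2l. Qed.

Lemma qdvd_norm f x : qdvd f x -> f ^+ 2 %| qnorm x.
Proof. by move=> /qdvdP[y ->]; rewrite qnormZ dvdp_mulr. Qed.

Lemma qdvd_prime N a x : irreducible_poly N ->
  qdvd N (a *: x) -> (N %| a) || qdvd N x.
Proof.
move=> Nirr; have [//|Na] := boolP (N %| a).
have cop : coprimep N a by rewrite irreducible_poly_coprime.
by rewrite /qdvd /= !Gauss_dvdpr.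
Qed.

(** Over an algebraic closure of [R[t]/N], quaternions become 2 x 2 matrices,
    and [x] is one with zero trace and determinant.  If [x y] is not zero, then
    [x] has rank one and its kernel is its image; if moreover [y^* x y] is
    zero, then [y] has rank one too, and its image, which is the kernel of
    [y^*], contains the image of [x].  So the image of [y] is the kernel
    of [x], and [x y] is zero after all.  The matrix-free form of this argument
    multiplies [y^* x y] by [z x] and uses [quat_sandwich]: [N] divides
    [tr (x y z) y^* x] for every [z]. *)
Lemma qdvd_isotropic N x y : irreducible_poly N -> quat_conj x = - x ->
  N %| qnorm x -> qdvd N (quat_conj y * x * y) -> qdvd N (x * y).
Proof.
move=> Nirr xskew Nx Nyxy.
have [Nyx|Nyx] := boolP (qdvd N (quat_conj y * x)).
  move: Nyx; rewrite -qdvd_conj quat_conjM quat_conjK xskew mulNr.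
  by rewrite qdvdN.
(* The four components of [x * y] are, up to sign, its traces against the
   basis quaternions. *)
have tr0 z : N %| q0 (x * y * z).
  suff : N %| q0 (x * y * z) *+ 2 by rewrite -scaler_nat dvdpZr ?pnatr_eq0.
  have : qdvd N (quat_conj y * x * y * (z * x)) by apply: qdvd_mulr.
  have -> : quat_conj y * x * y * (z * x) = quat_conj y * (x * (y * z) * x).
    by rewrite !mulrA.
  rewrite quat_sandwich mulrBr -!scalerAr addrC qdvdDr; last by rewrite qdvdN qdvd_scale.
  by rewrite -mulrA => /(qdvd_prime Nirr); rewrite (negbTE Nyx) orbF.
apply/and4P; split.
- by have := tr0 1; rewrite mulr1.
- have -> : q1 (x * y) = - q0 (x * y * Quat 0 1 0 0) by rewrite /=; ring.
  by rewrite dvdpNr tr0.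
- have -> : q2 (x * y) = - q0 (x * y * Quat 0 0 1 0) by rewrite /=; ring.
  by rewrite dvdpNr tr0.
- have -> : q3 (x * y) = - q0 (x * y * Quat 0 0 0 1) by rewrite /=; ring.
  by rewrite dvdpNr tr0.
Qed.

End PolynomialQuaternions.

(** * Products of linear motion polynomials of norm [N] *)

Section Factorizations.
Variables (R : realFieldType) (N : {poly R}).
Hypothesis Nirr : irreducible_poly N.
Implicit Types (x y z T : quat {poly R}) (m : dual (quat {poly R}))
  (ms As Cs : seq (dual (quat {poly R}))).

Definition quatC (p : quat R) : quat {poly R} :=
  Quat (q0 p)%:P (q1 p)%:P (q2 p)%:P (q3 p)%:P.

Definition linq (p : quat R) : quat {poly R} := 'X%:A - quatC p.

Lemma qnormC (p : quat R) : qnorm (quatC p) = (qnorm p)%:P.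
Proof. by rewrite /qnorm /= !polyCD !polyC_exp. Qed.

Lemma qnorm_eq0 (p : quat R) : qnorm p = 0 -> p = 0.
Proof.
rewrite /qnorm => /eqP; rewrite !paddr_eq0 ?addr_ge0 ?sqr_ge0 // !sqrf_eq0.
by case/andP => /andP[/andP[/eqP h0 /eqP h1] /eqP h2] /eqP h3; apply: quat_ext.
Qed.

Lemma irredp_dvdC (u : R) : (N %| u%:P) = (u == 0).
Proof.
have [->|u0] := eqVneq u 0; first by rewrite dvdp0.
have uP : u%:P != 0 by rewrite polyC_eq0.
apply/negP => /(dvdp_leq uP); apply/negP; rewrite -ltnNge size_polyC u0.
by case: Nirr.
Qed.

(** Both [linq p1] and the conjugate of [linq p2] annihilate [linq p2 * z]
    modulo [N].  Their difference is a constant quaternion; it annihilates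
    this product as well, so its norm, a real constant, is divisible by [N]
    and vanishes. *)
Lemma left_factor_uniq p1 p2 z :
  qnorm (linq p2) = N -> ~~ qdvd N (linq p2 * z) ->
  qdvd N (linq p1 * (linq p2 * z)) -> linq p1 = quat_conj (linq p2).
Proof.
move=> n2 Nw N1; set w := linq p2 * z in Nw N1.
pose d := quat_conj p2 - p1.
have dE : linq p1 - quat_conj (linq p2) = quatC d.
  by apply: quat_ext; rewrite /= ?polyCD ?polyCN; ring.
have N2 : qdvd N (quat_conj (linq p2) * w).
  by rewrite /w mulrA mul_conj_quat n2 -scalerAl qdvdZ.
have : qdvd N (qnorm (quatC d) *: w).
  rewrite -[w in X in qdvd _ X]mul1r scalerAl -mul_conj_quat -mulrA.
  by rewrite qdvd_mull // -dE mulrBl qdvdDr // qdvdN.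
move/(qdvd_prime Nirr); rewrite (negbTE Nw) orbF qnormC => Nd.
suff d0 : d = 0.
  apply/eqP; rewrite -subr_eq0 dE d0; apply/eqP.
  by apply: quat_ext.
by apply: qnorm_eq0; apply/eqP; rewrite -irredp_dvdC.
Qed.

(** The last clause says that the dual part of the norm vanishes. *)
Definition linear_motion m : Prop :=
  [/\ exists p, dprimal m = linq p, qnorm (dprimal m) = N
    & dprimal m * quat_conj (ddual m) + ddual m * quat_conj (dprimal m) = 0].

Definition ddvd m : bool := qdvd N (dprimal m) && qdvd N (ddual m).

Lemma ddvd_mull m1 m2 : ddvd m2 -> ddvd (m1 * m2).
Proof.
case/andP => h1 h2; apply/andP; split => /=; first exact: qdvd_mull.
by rewrite qdvdD // qdvd_mull.
Qed.

(** The reason why a reduced product contains a single excursion: the dual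
    part of a product is bilinear in the primal and dual parts of the two
    factors. *)
Lemma ddvd_mul2 m1 m2 : qdvd N (dprimal m1) -> qdvd N (dprimal m2) ->
  ddvd (m1 * m2).
Proof.
move=> h1 h2; apply/andP; split => /=; first exact: qdvd_mull.
by rewrite qdvdD // ?(qdvd_mulr _ h1) // qdvd_mull.
Qed.

(** The motion condition of [m2] reads [T^* d2^* + d2 T = 0] with [T] the primal
    part of [m1]; moving [T] to the other side makes the two dual
    contributions of [m1 * m2] right multiples of [T^*]. *)
Lemma linear_motion_skew m1 m2 : linear_motion m2 ->
  dprimal m1 = quat_conj (dprimal m2) ->
  dprimal m1 * ddual m2 = - (quat_conj (ddual m2) * quat_conj (dprimal m1)).
Proof.
move=> [_ n2 mo2] E1; apply/eqP; rewrite -addr_eq0; apply/eqP.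
set T := dprimal m1 in E1 *; set d2 := ddual m2 in mo2 *.
have E2 : dprimal m2 = quat_conj T by rewrite E1 quat_conjK.
have nT : qnorm T = N by rewrite E1 qnorm_conj.
(* This is the motion condition of [m2] conjugated by [T], and [N] cancels. *)
have : N *: (T * d2 + quat_conj d2 * quat_conj T) = 0.
  transitivity (T * (dprimal m2 * quat_conj d2 + d2 * quat_conj (dprimal m2))
                * quat_conj T); last by rewrite mo2 mulr0 mul0r.
  rewrite E2 quat_conjK mulrDr mulrDl !mulrA mul_quat_conj nT.
  rewrite -[T * d2 * T * _]mulrA mul_quat_conj nT scalerDr addrC.
  by rewrite -!scalerAl mul1r -scalerAr mulr1.
case: (_ + _) => a b c d [] /eqP + /eqP + /eqP + /eqP.
rewrite !mulf_eq0 (negbTE (irredp_neq0 Nirr)) /=.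
by move=> /eqP -> /eqP -> /eqP -> /eqP ->.
Qed.

(** Enclosing an excursion between a step [T] and its inverse step.  The dual
    part becomes [T E T^* + N ^+ a f T^*] with [f = d1 - d2^*]: the norms of
    the summands are [N ^+ 2] times that of [E] and [N ^+ (2 a + 1)] times that
    of [f], and the polar term gains a factor [N] from [T^* T].  Therefore the
    exponent in the norm of the dual part grows with the one in the primal
    part. *)
Lemma backtrack m1 m2 a E : linear_motion m1 -> linear_motion m2 ->
  dprimal m1 = quat_conj (dprimal m2) ->
  quat_conj E = - E -> N ^+ a %| qnorm E ->
  exists F, [/\ m1 * Dual (N ^+ a)%:A E * m2 = Dual (N ^+ a.+1)%:A F,
    quat_conj F = - F & N ^+ a.+1 %| qnorm F].
Proof.
move=> lm1 lm2 E12 Eskew Ea; have Td2 := linear_motion_skew lm2 E12.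
have [_ n1 mo1] := lm1; have [_ n2 _] := lm2.
have E2 : dprimal m2 = quat_conj (dprimal m1) by rewrite E12 quat_conjK.
case: m1 m2 {lm1 lm2 E12} n1 mo1 n2 E2 Td2 => T d1 [P2 d2] /=.
move=> nT mo1 n2 -> Td2; pose f := d1 - quat_conj d2.
exists (T * E * quat_conj T + (N ^+ a) *: (f * quat_conj T)); split.
- congr Dual => /=.
    rewrite -scalerAr mulr1 -scalerAl mul_quat_conj nT.
    by rewrite scalerA exprSr.
  rewrite -!scalerAr !mulr1 mulrDl -!scalerAl Td2 /f mulrBl.
  by rewrite scalerBr scalerN [LHS]addrC -addrA.
- rewrite quat_conjD !quat_conjM quat_conjK Eskew quat_conjZ quat_conjM.
  rewrite quat_conjK mulNr mulrN mulrA opprD; congr (_ + _).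
  rewrite -scalerN; congr (_ *: _); rewrite /f quat_conjD quat_conjN quat_conjK.
  rewrite mulrBr mulrBl Td2 opprB opprK addrC; congr (_ + _).
  by apply/eqP; rewrite -addr_eq0 mo1.
have Tinv : qnorm (quat_conj T) = N by rewrite qnorm_conj.
rewrite qnormD qnormZ !qnormM Tinv nT; apply: dvdp_add.
  apply: dvdp_add.
    by rewrite exprSr dvdp_mul // dvdp_mull.
  by rewrite exprSr mulrA dvdp_mul // expr2 -mulrA dvdp_mulr.
rewrite quat_conjZ quat_conjM quat_conjK -scalerAr.
rewrite mulrA -[T * E * _ * _]mulrA mul_conj_quat nT -scalerAr mulr1 -scalerAl.
by rewrite scalerA -exprSr q0Z -mulr_natr -mulrA dvdp_mulr.
Qed.

(** Induction on the number of factors.  A new factor on the left either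
    prolongs the geodesic described by [A] and [C], or cancels its first
    step.  A cancellation inside a nonempty [A]
    would start a second excursion and make the product divisible by [N]; so
    [A] is empty and the factor cancels the first step of [C], which makes the
    excursion longer by [backtrack].  The clause on [a = 0] fixes the cut
    point of a path without excursion at its left end, where the next
    cancellation takes place. *)
Lemma excursion ms : {in ms, forall m, linear_motion m} ->
  ~~ ddvd (\prod_(m <- ms) m) ->
  exists a As Cs E, [/\ {in As ++ Cs, forall m, linear_motion m},
    quat_conj E = - E /\ N ^+ a %| qnorm E,
    ~~ qdvd N (dprimal (\prod_(m <- As) m) * dprimal (\prod_(m <- Cs) m)),
    a = 0%N -> As = [::] /\ E = 0
  & \prod_(m <- ms) m
      = \prod_(m <- As) m * Dual (N ^+ a)%:A E * \prod_(m <- Cs) m].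
Proof.
have Nsz : (1 < size N)%N by case: Nirr.
have N1 : ~~ (N %| 1) by rewrite dvdp1 neq_ltn Nsz orbT.
elim: ms => [|m ms IH] lms Nms.
  exists 0%N, [::], [::], 0; split=> //.
  - by rewrite quat_conj0 oppr0 expr0 dvd1p.
  - by rewrite !big_nil mul1r /qdvd /= (negbTE N1).
  - by rewrite !big_nil expr0 scale1r mulr1 mul1r.
have lm : linear_motion m by apply: lms; rewrite mem_head.
have Nms' : ~~ ddvd (\prod_(m <- ms) m).
  by apply: contra Nms; rewrite big_cons; exact: ddvd_mull.
have [||a [As [Cs [E [lAC [Eskew Ea] NAC a0 msE]]]]] := IH => //.
  by move=> x xms; apply: lms; rewrite inE xms orbT.
set A := \prod_(m <- As) m in NAC msE; set C := \prod_(m <- Cs) m in NAC msE.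
(* Does the new step [m] cancel the next one, or prolong the geodesic? *)
have [TAC|TAC] := boolP (qdvd N (dprimal m * (dprimal A * dprimal C))); last first.
  have [a_0|a_n0] := eqVneq a 0%N.
    have [As0 E0] := a0 a_0; exists 0%N, [::], (m :: Cs), 0; split.
    - by move=> x; rewrite inE => /predU1P[-> //|xC]; apply: lAC; rewrite As0.
    - by rewrite quat_conj0 oppr0 expr0 dvd1p.
    - move: TAC; rewrite /A As0 !big_nil big_cons.
      by rewrite (mul1r (dprimal C)) (mul1r (dprimal (m * C))).
    - by [].
    - rewrite big_nil !big_cons msE /A As0 E0 a_0 expr0 scale1r big_nil -/C.
      rewrite (mul1r (Dual 1 0)) (mul1r C) (mul1r (m * C)); reflexivity.
  exists a, (m :: As), Cs, E; split.
  - by move=> x; rewrite inE => /predU1P[-> //|]; apply: lAC.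
  - by [].
  - by rewrite big_cons -/A -/C -mulrA in TAC *.
  - by move=> a_0; rewrite a_0 in a_n0.
  - rewrite !big_cons msE -/A -/C (mulrA m) (mulrA m); reflexivity.
have [[p1 mE1] nm _] := lm.
(* If [m] cancels the first factor of [A], both halves of the product have a
   primal part divisible by [N]. *)
case: As => [|m2 As] in lAC A NAC a0 msE TAC *; last first.
  case: a => [|a] in Ea a0 msE *; first by have [] := a0 erefl.
  have lm2 : linear_motion m2 by apply: lAC; rewrite mem_head.
  have [[p2 mE2] nm2 _] := lm2.
  case/negP: Nms; rewrite big_cons msE /A big_cons -!mulrA mulrA.
  apply: ddvd_mul2 => /=.
    rewrite mE1 mE2.
    rewrite (@left_factor_uniq p1 p2 (dprimal (\prod_(j <- As) j) * dprimal C)).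
    - by rewrite mul_conj_quat -mE2 nm2 qdvdZ.
    - by rewrite -mE2.
    - by move: NAC; rewrite /A big_cons /= -mE2 mulrA.
    - by move: TAC; rewrite /A big_cons /= -mE1 -mE2 !mulrA.
  apply: qdvd_mull; apply: qdvd_mulr; apply: qdvd_scale.
  by rewrite exprS dvdp_mulr.
(* With [A] and [C] empty, [N] would divide the primal part of [m], and its
   square the norm [N]. *)
case: Cs => [|m2 Cs] in lAC C NAC msE TAC *.
  move: TAC; rewrite /A /C !big_nil !mulr1 => /qdvd_norm; rewrite nm.
  move/(dvdp_leq (irredp_neq0 Nirr)).
  rewrite expr2 size_mul ?irredp_neq0 //.
  by rewrite leqNgt -subn1 ltn_subRL addnC ltn_add2l Nsz.
have lm2 : linear_motion m2 by apply: lAC; rewrite mem_head.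
have [[p2 mE2] nm2 _] := lm2.
have E12 : dprimal m = quat_conj (dprimal m2).
  rewrite mE1 mE2; apply: (@left_factor_uniq p1 p2 (dprimal (\prod_(j <- Cs) j))).
  - by rewrite -mE2.
  - by move: NAC; rewrite /A /C big_nil big_cons /= mul1r mE2.
  - by move: TAC; rewrite /A /C big_nil big_cons /= mul1r mE2 mE1.
have [F [FE Fskew Fa]] := backtrack lm lm2 E12 Eskew Ea.
exists a.+1, [::], Cs, F; split.
- by move=> x xC; apply: lAC; rewrite inE xC orbT.
- by [].
- move: NAC; rewrite /A /C !big_nil big_cons.
  rewrite (mul1r (dprimal (m2 * _))) (mul1r (dprimal (\prod_(j <- Cs) j))).
  by apply: contra; exact: qdvd_mull.
- by [].
- rewrite big_cons msE /A /C big_nil big_cons -FE.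
  rewrite (mul1r (Dual _ E)) (mul1r (_ * m2)) (mulrA m) (mulrA (m * _)).
  reflexivity.
Qed.

Lemma qnorm_prod ms : {in ms, forall m, linear_motion m} ->
  qnorm (dprimal (\prod_(m <- ms) m)) = N ^+ size ms.
Proof.
elim: ms => [|m ms IH] lms; first by rewrite big_nil qnorm1.
rewrite big_cons qnormM IH => [|x xms]; last by apply: lms; rewrite inE xms orbT.
by have [_ -> _] := lms m (mem_head _ _); rewrite -exprS.
Qed.

Lemma qnorm_dvd_prod ms m : m \in ms ->
  qnorm (dprimal m) %| qnorm (dprimal (\prod_(x <- ms) x)).
Proof.
elim: ms => // x ms IH; rewrite inE big_cons qnormM => /predU1P[->|/IH h].
  by rewrite dvdp_mulr.
by rewrite dvdp_mull.
Qed.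

Lemma dvdp_irred_exp f n : f %| N ^+ n -> exists2 m, (m <= n)%N & f %= N ^+ m.
Proof.
elim: n f => [|n IH] f fN; first by exists 0%N => //; rewrite expr0 -size_poly_eq1 -dvdp1.
have [/dvdpP[g fE]|Nf] := boolP (N %| f); last first.
  exists 0%N => //; rewrite expr0 -size_poly_eq1 -dvdp1 -(@Gauss_dvdpr _ 1 (N ^+ n.+1)) ?mulr1 //.
  by rewrite coprimep_expr // coprimep_sym irreducible_poly_coprime.
have N0 := irredp_neq0 Nirr.
have [|m mn gm] := IH g; first by rewrite -(dvdp_mul2r _ _ N0) -fE -exprSr.
by exists m.+1; rewrite // fE exprSr eqp_mul2r.
Qed.

Lemma qscale_exp_inj a b x y : ~~ qdvd N x -> ~~ qdvd N y ->
  N ^+ a *: x = N ^+ b *: y -> a = b /\ x = y.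
Proof.
wlog ab : a b x y / (a <= b)%N => [H|] Nx Ny xy.
  have [ab|/ltnW ba] := leqP a b; first exact: H.
  by have [-> ->] := H _ _ _ _ ba Ny Nx (esym xy).
have Na0 : N ^+ a != 0 by rewrite expf_neq0 // irredp_neq0.
have xE : x = N ^+ (b - a) *: y.
  move: xy; rewrite -{1}(subnKC ab) exprD -scalerA => -[].
  move=> /(mulfI Na0) e0 /(mulfI Na0) e1 /(mulfI Na0) e2 /(mulfI Na0) e3.
  exact: quat_ext.
move: ab xE; rewrite leq_eqVlt => /predU1P[-> |]; first by rewrite subnn scale1r.
rewrite -subn_gt0; case: (b - a)%N => // i _ xE.
by case/negP: Nx; rewrite xE qdvd_scale // exprS dvdp_mulr.
Qed.

(** * Divisibility along an excursion *)

Section ExcursionProduct.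
Variables (a j k : nat) (A0 A1 C0 C1 E D : quat {poly R}).
Hypotheses (nA : qnorm A0 = N ^+ j) (nC : qnorm C0 = N ^+ k).
Hypotheses (Eskew : quat_conj E = - E) (Ea : N ^+ a %| qnorm E).
Let F := A1 * C0 + A0 * C1.
Hypothesis DE : D = A0 * E * C0 + N ^+ a *: F.

(** The polar term of the two summands of [D] is [N ^+ a] times the traces of
    [A0 E C0 C0^* A1^*] and [A0 E C0 C1^* A0^*]; the first contains the norm of
    [C0], and the second, after a cyclic rotation, the norm of [A0]. *)
Lemma exp_dvd_qnorm_dual i : (i <= j)%N -> (i <= k)%N -> (i <= a)%N ->
  N ^+ (a + i) %| qnorm D.
Proof.
move=> ij ik ia; rewrite DE qnormD qnormZ !qnormM nA nC exprD.
apply: dvdp_add; first apply: dvdp_add.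
- by rewrite -mulrA dvdp_mull // dvdp_mul // dvdp_exp2l.
- by rewrite expr2 -mulrA dvdp_mul // dvdp_mulr // dvdp_exp2l.
rewrite quat_conjZ -scalerAr q0Z -mulr_natr -mulrA dvdp_mul // dvdp_mulr //.
rewrite /F quat_conjD !quat_conjM mulrDr q0D; apply: dvdp_add.
  rewrite -[A0 * E * C0 * _]mulrA [C0 * _]mulrA mul_quat_conj nC.
  by rewrite -scalerAl mul1r -scalerAr q0Z dvdp_mulr // dvdp_exp2l.
rewrite mulrA q0_mulC !mulrA mul_conj_quat nA -!scalerAl q0Z.
by rewrite dvdp_mulr // dvdp_exp2l.
Qed.

(** Since [(A0 C0)^* D] is [N ^+ j C0^* E C0] modulo [N ^+ a], divisibility by a
    higher power of [N] than [j] is excluded by [qdvd_isotropic], which would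
    make [N] divide [E C0] and then [D]. *)
Lemma exp_dvd_left l : (l <= a)%N -> ~~ (qdvd N D && (0 < a)%N) ->
  qdvd (N ^+ l) (quat_conj (A0 * C0) * D) -> (l <= j)%N.
Proof.
move=> la ND Nl; rewrite leqNgt; apply: contra ND => jl.
have a0 : (0 < a)%N by apply: leq_trans la; apply: leq_ltn_trans jl.
have Na : N %| N ^+ a by rewrite -[N in N %| _]expr1 dvdp_exp2l.
rewrite a0 andbT DE addrC qdvdDr ?qdvd_scale // -mulrA qdvd_mull //.
apply: qdvd_isotropic => //; first exact: dvdp_trans Ea.
have /qdvd_trans/(_ Nl) : N ^+ j.+1 %| N ^+ l by rewrite dvdp_exp2l.
rewrite DE quat_conjM mulrDr addrC qdvdDr; last first.
  rewrite -scalerAr; apply: qdvd_scale; rewrite dvdp_exp2l //.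
  exact: leq_trans la.
rewrite !mulrA -[_ * quat_conj A0 * A0]mulrA mul_conj_quat nA.
rewrite -scalerAr mulr1 -!scalerAl exprSr qdvd_scale2 //.
by rewrite expf_neq0 // irredp_neq0.
Qed.

(** The mirror image of [exp_dvd_left]: [D (A0 C0)^*] is [N ^+ k A0 E A0^*]
    modulo [N ^+ a], and [qdvd_isotropic] applies to the conjugate of [A0]. *)
Lemma exp_dvd_right l : (l <= a)%N -> ~~ (qdvd N D && (0 < a)%N) ->
  qdvd (N ^+ l) (D * quat_conj (A0 * C0)) -> (l <= k)%N.
Proof.
move=> la ND Nl; rewrite leqNgt; apply: contra ND => kl.
have a0 : (0 < a)%N by apply: leq_trans la; apply: leq_ltn_trans kl.
have Na : N %| N ^+ a by rewrite -[N in N %| _]expr1 dvdp_exp2l.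
rewrite a0 andbT DE addrC qdvdDr ?qdvd_scale // qdvd_mulr //.
rewrite -qdvdN -mulrN -Eskew -qdvd_conj quat_conjM quat_conjK.
apply: qdvd_isotropic => //; first exact: dvdp_trans Ea.
rewrite quat_conjK.
have /qdvd_trans/(_ Nl) : N ^+ k.+1 %| N ^+ l by rewrite dvdp_exp2l.
rewrite DE quat_conjM mulrDl addrC qdvdDr; last first.
  rewrite -scalerAl; apply: qdvd_scale; rewrite dvdp_exp2l //.
  exact: leq_trans la.
rewrite mulrA -[_ * C0 * _]mulrA mul_quat_conj nC.
rewrite -scalerAr mulr1 -!scalerAl exprSr qdvd_scale2 //.
by rewrite expf_neq0 // irredp_neq0.
Qed.

End ExcursionProduct.

(** Comparing the primal parts of [M] and of its decomposition along the
    excursion gives [c = u N ^+ a] and [A0 C0 = u Q] for a real constant [u],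
    as [N] divides neither [Q] nor [A0 C0]. *)
Lemma dual_norm_divisibility ms (c gL gR : {poly R}) n
    (Q D : quat {poly R}) :
  {in ms, forall m, linear_motion m} ->
  \prod_(m <- ms) m = Dual (c *: Q) D ->
  ~~ ddvd (Dual (c *: Q) D) -> ~~ qdvd N Q -> c %| N ^+ n ->
  gL %| c -> qdvd gL (quat_conj Q * D) ->
  gR %| c -> qdvd gR (D * quat_conj Q) ->
  (c * gL %| qnorm D) || (c * gR %| qnorm D).
Proof.
move=> lms MDE NM NQ cN gLc gLD gRc gRD.
have [||a [As [Cs [E [lAC [Eskew Ea] NAC _ ME]]]]] := @excursion ms => //.
  by rewrite MDE.
have nA : qnorm (dprimal (\prod_(m <- As) m)) = N ^+ size As.
  by apply: qnorm_prod => m mA; apply: lAC; rewrite mem_cat mA.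
have nC : qnorm (dprimal (\prod_(m <- Cs) m)) = N ^+ size Cs.
  by apply: qnorm_prod => m mC; apply: lAC; rewrite mem_cat mC orbT.
move: ME nA nC NAC; rewrite MDE.
case: (\prod_(m <- As) m) => A0 A1; case: (\prod_(m <- Cs) m) => C0 C1 ME.
set j := size As; set k := size Cs => /= nA nC NAC.
have PE : c *: Q = N ^+ a *: (A0 * C0).
  by rewrite -[LHS]/(dprimal (Dual (c *: Q) D)) ME /= -scalerAr mulr1 -scalerAl.
have DE : D = A0 * E * C0 + N ^+ a *: (A1 * C0 + A0 * C1).
  rewrite -[LHS]/(ddual (Dual (c *: Q) D)) ME /= -!scalerAr !mulr1.
  rewrite -!scalerAl mulrDl scalerDr -!scalerAl addrC addrA.
  by congr (_ + _); rewrite addrC.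
have [m _ cm] := dvdp_irred_exp cN.
have /eqpf_eq[u u0 cE] := cm.
have [ma QE] : m = a /\ u%:P *: Q = A0 * C0.
  apply: qscale_exp_inj => //.
    by apply: contra NQ => /(qdvd_prime Nirr)/orP[|//]; rewrite irredp_dvdC (negbTE u0).
  by rewrite scalerA mulrC mul_polyC -cE.
rewrite ma in cm.
have expn_of g : g %| c -> exists2 l, (l <= a)%N & g %= N ^+ l.
  by rewrite (eqp_dvdr _ cm); exact: dvdp_irred_exp.
have [l la gl] := expn_of _ gLc; have [r ra gr] := expn_of _ gRc.
have ND : ~~ (qdvd N D && (0 < a)%N).
  apply: contra NM => /andP[ND a0]; apply/andP; split=> //=.
  by rewrite PE qdvd_scale // -[N in N %| _]expr1 dvdp_exp2l.
have lj : (l <= j)%N.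
  apply: (exp_dvd_left nA Eskew Ea DE la ND).
  rewrite -QE quat_conjZ -scalerAl.
  apply: (qdvd_trans (g := gL)); first by rewrite (eqp_dvdr _ gl).
  case/qdvdP: gLD => w ->; apply/qdvdP; exists (u%:P *: w).
  by rewrite !scalerA mulrC.
have rk : (r <= k)%N.
  apply: (exp_dvd_right nC Eskew Ea DE ra ND).
  rewrite -QE quat_conjZ -scalerAr.
  apply: (qdvd_trans (g := gR)); first by rewrite (eqp_dvdr _ gr).
  case/qdvdP: gRD => w ->; apply/qdvdP; exists (u%:P *: w).
  by rewrite !scalerA mulrC.
have cg g i : g %= N ^+ i -> c * g %= N ^+ (a + i).
  by move=> gi; rewrite exprD (eqp_trans (eqp_mulr g cm)) // eqp_mull.
rewrite (eqp_dvdl _ (cg _ _ gl)) (eqp_dvdl _ (cg _ _ gr)).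
have [jk|kj] := leqP j k.
  by rewrite (exp_dvd_qnorm_dual nA nC Ea DE) // (leq_trans lj).
by rewrite orbC (exp_dvd_qnorm_dual nA nC Ea DE) // ltnW // (leq_ltn_trans rk).
Qed.

End Factorizations.

(** * Quaternion polynomials as quaternions over the polynomial ring *)

Section Coefficients.
Variable R : realType.
Implicit Types (f g : {poly R}) (P Q D : {poly quat R}) (M : {poly dquat R})
  (x y : quat {poly R}).

Definition polyq P : quat {poly R} :=
  Quat (map_poly (@q0 R) P) (map_poly (@q1 R) P)
       (map_poly (@q2 R) P) (map_poly (@q3 R) P).

Definition qcoef x i : quat R := Quat (q0 x)`_i (q1 x)`_i (q2 x)`_i (q3 x)`_i.

Lemma qcoef_polyq P i : qcoef (polyq P) i = P`_i.
Proof. by rewrite /qcoef /= !coef_map_id0 //; case: P`_i. Qed.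

Lemma qcoef_inj x y : (forall i, qcoef x i = qcoef y i) -> x = y.
Proof.
by move=> xy; apply: quat_ext; apply/polyP => i; case: (xy i).
Qed.

Lemma polyq_inj : injective polyq.
Proof. by move=> P Q PQ; apply/polyP => i; rewrite -!qcoef_polyq PQ. Qed.

Lemma polyq_surj x : exists P, polyq P = x.
Proof.
pose s := (size (q0 x) + size (q1 x) + size (q2 x) + size (q3 x))%N.
exists (\poly_(i < s) qcoef x i); apply: qcoef_inj => i.
rewrite qcoef_polyq coef_poly; case: ltnP => // si.
apply/esym/quat_ext => /=; apply: nth_default; apply: leq_trans si.
- by rewrite /s -!addnA leq_addr.
- by rewrite /s -addnA -addnA addnCA leq_addr.
- by rewrite /s -addnA addnCA leq_addr.
- by rewrite /s leq_addl.
Qed.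

Lemma qcoefM x y i :
  qcoef (x * y) i = \sum_(j < i.+1) qcoef x j * qcoef y (i - j).
Proof.
apply: quat_ext.
- rewrite (big_morph (@q0 R) (id1 := 0) (op1 := +%R)) //=.
  by rewrite !coefB !coefM -!sumrB.
- rewrite (big_morph (@q1 R) (id1 := 0) (op1 := +%R)) //=.
  by rewrite coefB !coefD !coefM -!big_split -!sumrB.
- rewrite (big_morph (@q2 R) (id1 := 0) (op1 := +%R)) //=.
  by rewrite 2!coefD coefB !coefM -sumrB -!big_split.
- rewrite (big_morph (@q3 R) (id1 := 0) (op1 := +%R)) //=.
  by rewrite coefD coefB coefD !coefM -big_split -sumrB -big_split.
Qed.

Lemma qcoefD x y i : qcoef (x + y) i = qcoef x i + qcoef y i.
Proof. by apply: quat_ext; rewrite /= coefD. Qed.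

Lemma polyqM P Q : polyq (P * Q) = polyq P * polyq Q.
Proof.
apply: qcoef_inj => i; rewrite qcoef_polyq qcoefM coefM.
by apply: eq_bigr => j _; rewrite !qcoef_polyq.
Qed.

Lemma polyqD P Q : polyq (P + Q) = polyq P + polyq Q.
Proof. by apply: qcoef_inj => i; rewrite qcoefD !qcoef_polyq coefD. Qed.

Lemma polyq_conj P : polyq (conjH P) = quat_conj (polyq P).
Proof.
apply: qcoef_inj => i; rewrite qcoef_polyq coef_map_id0; last first.
  by apply: quat_ext; rewrite /= ?oppr0.
by rewrite -qcoef_polyq; apply: quat_ext; rewrite /= ?coefN.
Qed.

Lemma polyq_scalp f : polyq (scalp_poly f) = f%:A.
Proof.
apply: qcoef_inj => i; rewrite qcoef_polyq coef_map.
by apply: quat_ext; rewrite /= ?mulr1 ?mulr0 ?coef0.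
Qed.

Lemma polyq_XsubC (p : quat R) : polyq ('X - p%:P) = linq p.
Proof.
apply: qcoef_inj => i; rewrite qcoef_polyq coefB coefX coefC /linq /quatC.
apply: quat_ext; rewrite /= coefB coefC ?mulr1 ?mulr0 ?coefX ?coef0.
all: by case: i => [|[|i]].
Qed.

Lemma rdvd_polyq f P : rdvd f P <-> qdvd f (polyq P).
Proof.
split=> [[P' ->]|/qdvdP[x xE]].
  by rewrite polyqM polyq_scalp -scalerAl mul1r qdvdZ.
have [P' P'E] := polyq_surj x; exists P'; apply: polyq_inj.
by rewrite polyqM polyq_scalp -scalerAl mul1r P'E.
Qed.

Definition dpolyq M : dual (quat {poly R}) :=
  Dual (polyq (map_poly (@dprimal (quat R)) M))
       (polyq (map_poly (@ddual (quat R)) M)).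

Lemma dpolyqM M M' : dpolyq (M * M') = dpolyq M * dpolyq M'.
Proof.
congr Dual; rewrite /= -?polyqM -?polyqD; congr polyq; apply/polyP => i.
  rewrite coef_map_id0 // !coefM.
  rewrite (big_morph (@dprimal _) (id1 := 0) (op1 := +%R)) //.
  by apply: eq_bigr => j _; rewrite !coef_map_id0.
rewrite coef_map_id0 // coefD !coefM.
rewrite (big_morph (@ddual _) (id1 := 0) (op1 := +%R)) //.
by rewrite -big_split; apply: eq_bigr => j _; rewrite !coef_map_id0.
Qed.

Lemma dpolyq_lift P D :
  dpolyq (liftH P + epsilon R * liftH D) = Dual (polyq P) (polyq D).
Proof.
congr Dual; congr polyq; apply/polyP => i.
  by rewrite coef_map_id0 // coefD coefCM !coef_map_id0 //= mul0r addr0.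
by rewrite coef_map_id0 // coefD coefCM !coef_map_id0 //= mul1r mul0r !add0r.
Qed.

Lemma dpolyq_inj : injective dpolyq.
Proof.
move=> M M' MM'; apply/polyP => i.
have := congr1 (fun P => P`_i) (polyq_inj (congr1 (@dprimal _) MM')).
have := congr1 (fun P => P`_i) (polyq_inj (congr1 (@ddual _) MM')).
rewrite /= !coef_map_id0 //.
by case: M`_i M'`_i => a b [a' b'] /= -> ->.
Qed.

Lemma dpolyq_surj (m : dual (quat {poly R})) : exists M, dpolyq M = m.
Proof.
case: m => x y; have [P <-] := polyq_surj x; have [D <-] := polyq_surj y.
by exists (liftH P + epsilon R * liftH D); rewrite dpolyq_lift.
Qed.

Lemma dpolyq_scalp f : dpolyq (scalp_poly f) = Dual f%:A 0.
Proof.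
rewrite -polyq_scalp /dpolyq; congr Dual; last first.
  apply: qcoef_inj => i; rewrite qcoef_polyq coef_map_id0 // coef_map /=.
  by apply: quat_ext; rewrite /= ?mulr0 coef0.
by congr polyq; apply/polyP => i; rewrite coef_map_id0 // !coef_map.
Qed.

Lemma dpolyq_conj M :
  dpolyq (conjDH M) = Dual (quat_conj (dprimal (dpolyq M)))
                           (quat_conj (ddual (dpolyq M))).
Proof.
have c0 : quat_conj (0 : quat R) = 0 by rewrite quat_conj0.
have dc0 : dquat_conj (0 : dquat R) = 0 by rewrite /dquat_conj /= c0.
congr Dual; rewrite /= -polyq_conj; congr polyq; apply/polyP => i;
  by rewrite coef_map_id0 // !coef_map_id0 // coef_map_id0.
Qed.

Lemma dpolyq_prod (I : Type) (s : seq I) (F : I -> {poly dquat R}) :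
  dpolyq (\prod_(h <- s) F h) = \prod_(h <- s) dpolyq (F h).
Proof.
apply: big_morph; first exact: dpolyqM.
by rewrite -(rmorph1 scalp_poly) dpolyq_scalp scale1r.
Qed.

Lemma dpolyq_XsubC h :
  dpolyq ('X - h%:P) = Dual (linq (dprimal h)) (- quatC (ddual h)).
Proof.
congr Dual; rewrite -?polyq_XsubC.
  congr polyq; apply/polyP => i; rewrite coef_map_id0 // !coefB !coefX !coefC.
  by case: i => [|[|i]].
apply: qcoef_inj => i; rewrite qcoef_polyq coef_map_id0 // coefB coefX coefC.
apply: quat_ext; rewrite /= coefN coefC; case: i => [|[|i]] /=.
all: by rewrite ?add0r ?oppr0 ?addr0.
Qed.

Lemma rdvd_dpolyq f M : ddvd f (dpolyq M) -> rdvd f M.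
Proof.
case/andP => /qdvdP[x xE] /qdvdP[y yE].
have [M' M'E] := dpolyq_surj (Dual x y); exists M'; apply: dpolyq_inj.
rewrite dpolyqM dpolyq_scalp M'E; congr Dual => /=.
  by rewrite -[LHS]/(dprimal (dpolyq M)) xE -scalerAl mul1r.
by rewrite -[LHS]/(ddual (dpolyq M)) yE -scalerAl mul1r mul0r addr0.
Qed.

Lemma qnorm_linq_monic (p : quat R) :
  qnorm (linq p) \is monic /\ size (qnorm (linq p)) = 3%N.
Proof.
pose e := q1 p ^+ 2 + q2 p ^+ 2 + q3 p ^+ 2.
have -> : qnorm (linq p) = ('X - (q0 p)%:P) ^+ 2 + e%:P.
  by rewrite /qnorm /e /= !polyCD !polyC_exp; ring.
have sz : size (('X - (q0 p)%:P) ^+ 2) = 3%N by rewrite size_exp_XsubC.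
have lt : (size e%:P < size (('X - (q0 p)%:P) ^+ 2))%N.
  by rewrite sz (leq_ltn_trans (size_polyC_leq1 _)).
rewrite size_polyDl // monicE lead_coefDl //; split=> //.
by rewrite -monicE monic_exp // monicXsubC.
Qed.

Lemma motion_dpolyq M : motion_poly M ->
  dprimal (dpolyq M) * quat_conj (ddual (dpolyq M)) +
  ddual (dpolyq M) * quat_conj (dprimal (dpolyq M)) = 0.
Proof.
case=> F _ /(congr1 dpolyq); rewrite dpolyqM dpolyq_conj dpolyq_scalp.
by move/(congr1 (@ddual _)).
Qed.

End Coefficients.

(** * The divisibility criterion *)

Lemma mrpf1_eq1_dvd (R : fieldType) (A : algType R) (B : {poly A}) (f : {poly R}) :
  B != 0 -> mrpf1 B = 1 -> f \is monic -> rdvd f B -> f %| 1.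
Proof.
move=> B0 B1 fm fB; have [_ _ _] := mrpfP (or_introl B0 : B != 0 \/ B != 0).
by rewrite -/(mrpf1 B) B1; exact.
Qed.

Theorem proposition4 (R : realType) (n : nat) (c N : {poly R})
    (Q D : {poly quat R}) (M : {poly dquat R})
    (M_def : M = liftH (scalp_poly c * Q) + epsilon R * liftH D)
    (M_monic : M \is monic)
    (M_motion : motion_poly M)
    (M_reduced : reduced M)
    (M_bounded : bounded M)
    (M_degree : size M = n.+1)
    (mrpf_Q : mrpf1 Q = 1)
    (N_irr : irreducible_poly N)
    (N_quadratic : size N = 3%N)
    (nu_M : nuDH M = liftH (scalp_poly (c ^+ 2) * nuH Q))
    (nu_MN : scalp_poly (c ^+ 2) * nuH Q = scalp_poly (N ^+ n))
    (M_factors : admits_linear_factorization M) :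
  let gL := mrpf (scalp_poly c) (conjH Q * D) in
  let gR := mrpf (scalp_poly c) (D * conjH Q) in
  rdvd (c * gL) (nuH D) \/ rdvd (c * gR) (nuH D).
Proof.
move=> gL gR.
have [hs [hs_motion ME]] := M_factors.
(* [N] is normalized so that it equals the norm of every linear factor. *)
pose u := (lead_coef N)^-1; pose N1 := u *: N.
have N0 := irredp_neq0 N_irr.
have u0 : u != 0 by rewrite invr_eq0 lead_coef_eq0.
have N1N : N1 %= N by apply: eqp_scale.
have N1m : N1 \is monic by rewrite monicE lead_coefZ mulVf ?lead_coef_eq0.
have N1irr : irreducible_poly N1.
  split; first by rewrite (eqp_size N1N); case: N_irr.
  by move=> q q1; rewrite (eqp_dvdr _ N1N) (eqp_rtrans N1N); apply: N_irr.2.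
have normE : c ^+ 2 * qnorm (polyq Q) = N ^+ n.
  have := congr1 (@polyq R) nu_MN.
  rewrite polyqM /nuH polyqM polyq_conj mul_quat_conj !polyq_scalp.
  by move/(congr1 (@q0 _)) => /=; rewrite !mulr1 !mulr0 !subr0.
have dME : dpolyq M = Dual (c *: polyq Q) (polyq D).
  by rewrite M_def dpolyq_lift polyqM polyq_scalp -scalerAl mul1r.
pose ms := [seq dpolyq ('X - h%:P) | h <- hs].
have msE : \prod_(m <- ms) m = Dual (c *: polyq Q) (polyq D).
  by rewrite -dME ME dpolyq_prod big_map.
have normP : qnorm (dprimal (\prod_(m <- ms) m)) = N ^+ n.
  by rewrite msE qnormZ normE.
have lms : {in ms, forall m, linear_motion N1 m}.
  move=> m mms; have /mapP[h hhs mE] := mms; rewrite mE in mms *; split.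
  - by exists (dprimal h); rewrite dpolyq_XsubC.
  - rewrite dpolyq_XsubC /=; have [Tm Tsz] := qnorm_linq_monic (dprimal h).
    have TN : qnorm (linq (dprimal h)) %| N ^+ n.
      by have := qnorm_dvd_prod mms; rewrite normP dpolyq_XsubC.
    have [k _ Tk] := dvdp_irred_exp N_irr TN.
    apply/eqP; rewrite -eqp_monic //.
    have k1 : k = 1%N.
      have := size_exp N k; rewrite -(eqp_size Tk) Tsz N_quadratic /=.
      by move/eqP; rewrite -{1}[2%N]muln1 eqn_pmul2l // => /eqP.
    by rewrite eqp_sym (eqp_trans N1N) // eqp_sym; rewrite k1 expr1 in Tk.
  - exact/motion_dpolyq/hs_motion.
have M0 : M != 0 by apply: monic_neq0.
have N11 : ~~ (N1 %| 1) by rewrite dvdp1 (eqp_size N1N) N_quadratic.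
have NM : ~~ ddvd N1 (Dual (c *: polyq Q) (polyq D)).
  apply: contra N11; rewrite -dME => /rdvd_dpolyq.
  exact: mrpf1_eq1_dvd M_reduced N1m.
have cQ0 : c ^+ 2 * qnorm (polyq Q) != 0 by rewrite normE expf_neq0.
have c0 : c != 0 by apply: contraNneq cQ0 => ->; rewrite expr0n mul0r.
have Q0 : Q != 0.
  apply: contraNneq cQ0 => ->.
  by rewrite /qnorm /= !map_poly0 expr0n !addr0 mulr0.
have NQ : ~~ qdvd N1 (polyq Q).
  apply: contra N11 => /rdvd_polyq.
  exact: mrpf1_eq1_dvd mrpf_Q N1m.
have cN : c %| N1 ^+ n.
  rewrite (eqp_dvdr _ (eqp_exp _ N1N)) -normE expr2 -mulrA dvdp_mulr //.
have sc0 : scalp_poly c != 0 :> {poly quat R}.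
  by rewrite -size_poly_gt0 size_map_poly size_poly_gt0.
have dvdc g : rdvd g (scalp_poly c : {poly quat R}) -> g %| c.
  by move=> /rdvd_polyq; rewrite polyq_scalp => /and4P[] /=; rewrite mulr1.
have [_ /dvdc gLc /rdvd_polyq gLD _] :=
  mrpfP (or_introl sc0 : _ \/ conjH Q * D != 0).
have [_ /dvdc gRc /rdvd_polyq gRD _] :=
  mrpfP (or_introl sc0 : _ \/ D * conjH Q != 0).
rewrite polyqM polyq_conj in gLD; rewrite polyqM polyq_conj in gRD.
have := dual_norm_divisibility N1irr lms msE NM NQ cN gLc gLD gRc gRD.
have toR g : c * g %| qnorm (polyq D) -> rdvd (c * g) (nuH D).
  move=> h; apply/rdvd_polyq; rewrite polyqM polyq_conj mul_quat_conj.
  exact: qdvd_scale.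
by case/orP => /toR; [left|right].
Qed.
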